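(* Let $\mathbb T\in\{\mathbb R_{+},\mathbb R\}$ and let $f\in C(\mathbb T\times\mathbb R,\mathbb R)$. Suppose that: (1) $f$ is asymptotically almost periodic (respectively, asymptotically $\tau$-periodic with a given $\tau>0$, or asymptotically stationary) in time $t$ uniformly with respect to $x$ on every compact subset of $\mathbb R$; (2) $f$ is positively regular; (3) $f$ is monotone with respect to $x$ uniformly in $t$, i.e., for all $x_1,x_2\in\mathbb R$ with $x_1\le x_2$ we have $f(t,x_1)\le f(t,x_2)$ for all $t\in\mathbb T$; (4) the solution $\varphi(t,u_0,f)$ of the equation $x'(t)=f(t,x)$ with $\varphi(0,u_0,f)=u_0$ (for some $u_0\in\mathbb R$) is bounded on $\mathbb R_{+}$. Then the function $t\mapsto\varphi(t,u_0,f)$, $t\in\mathbb R_+$, is remotely almost periodic (respectively, remotely $\tau$-periodic, or remotely stationary).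
   Context: $\mathbb R_+=[0,+\infty)$. $C(\mathbb T\times\mathbb R,\mathbb R)$ is the space of continuous functions $\mathbb T\times\mathbb R\to\mathbb R$ with the compact-open topology (uniform convergence on compact sets). For $h\ge 0$, $f^h(t,x):=f(t+h,x)$, and $H^{+}(f)$ is the closure of $\{f^h: h\ge 0\}$ in $C(\mathbb T\times\mathbb R,\mathbb R)$. Positively regular: for every $g\in H^{+}(f)$ and $v\in\mathbb R$ there is a unique solution $\varphi(t,v,g)$ of $y'=g(t,y)$ with $\varphi(0,v,g)=v$, defined on $\mathbb R_+$. Asymptotically almost periodic (respectively, asymptotically $\tau$-periodic, asymptotically stationary) in $t$ uniformly with respect to $x$ on compact subsets: there are $p,r\in C(\mathbb R\times\mathbb R,\mathbb R)$ with $f=p+r$ on $\mathbb T\times\mathbb R$, such that $\lim_{t\to+\infty}|r(t,x)|=0$ uniformly with respect to $x$ on every compact subset of $\mathbb R$, and $p$ is almost periodic in $t$ uniformly with respect to $x$ on every compact subset of $\mathbb R$ (respectively, $p(t+\tau,x)=p(t,x)$ for all $(t,x)$; or $p(t,x)$ does not depend on $t$). Here $p$ is almost periodic in $t$ uniformly on compacts if for every $\varepsilon>0$ and compact $Q\subset\mathbb R$ there is $l>0$ such that every segment $[a,a+l]$, $a\in\mathbb R$, contains a number $s$ with $|p(t+s,x)-p(t,x)|<\varepsilon$ for all $t\in\mathbb R$, $x\in Q$. A continuous function $\varphi:\mathbb R_+\to\mathbb R$ is: - remotely almost periodic if for every $\varepsilon>0$ there is $l=l(\varepsilon)>0$ such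 that every segment $[a,a+l]$, $a\ge 0$, contains a number $s$ for which there is $L=L(\varepsilon,s)>0$ with $|\varphi(t+s)-\varphi(t)|<\varepsilon$ for all $t\ge L$; - remotely $\tau$-periodic if $\lim_{t\to+\infty}|\varphi(t+\tau)-\varphi(t)|=0$; - remotely stationary if it is remotely $s$-periodic for every $s>0$. *)

(* Defs.v *)
From HB Require Import structures.
From mathcomp Require Import all_boot all_order all_algebra.
From mathcomp Require Import all_classical all_reals all_analysis.
Import Order.TTheory GRing.Theory Num.Theory.
Import numFieldNormedType.Exports.

Set Implicit Arguments.
Unset Strict Implicit.
Unset Printing Implicit Defensive.

Local Open Scope classical_set_scope.
Local Open Scope ring_scope.

Definition Rplus (R : realType) : set R := [set t | 0 <= t].

(* A set [T : set R] used as a type is [{t : R | t \in T}], with the topology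
   induced by [R].  An equation x' = g(t, x) is thus given by a function
   [g : T * R -> R].

   [insubd t s] is [s] seen as an element of [T], and the junk value [t] when
   [s] is not in [T]; for [T] equal to [Rplus R] or to [setT] and [0 <= h] the
   junk value is never used. *)
Definition translate (R : realType) (T : set R) (f : T * R -> R) (h : R) :
    T * R -> R :=
  fun z => f (insubd z.1 (val z.1 + h), z.2).

(* Closure in the space of continuous functions: [{family compact, _ -> _}] is
   the library's topology of uniform convergence on compact sets, which it puts
   on all functions, whence the first component. *)
Definition hull (R : realType) (T : set R) (f : T * R -> R) :
    set (T * R -> R) :=
  [set g | continuous g] `&`
  closure ([set translate f h | h in @Rplus R]
           : set {family compact, (T * R)%type -> R}).

(* Only the values of [y] on [0, +oo[ matter; the derivative at [t] is taken
   relatively to [0, +oo[, hence is one-sided at [t = 0]. *)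
Definition solution (R : realType) (T : set R) (g : T * R -> R) (v : R)
    (y : R -> R) : Prop :=
  y 0 = v /\
  forall t : T, 0 <= val t ->
    h^-1 * (y (val t + h) - y (val t))
      @[h --> within [set h | 0 <= val t + h] (0 : R)^'] --> g (t, y (val t)).

Definition positively_regular (R : realType) (T : set R) (f : T * R -> R) :
    Prop :=
  forall g, hull f g -> forall v : R,
    exists2 y : R -> R, solution g v y &
      forall z : R -> R, solution g v z -> forall t, 0 <= t -> z t = y t.

Definition almost_periodic_unif (R : realType) (p : R -> R -> R) : Prop :=
  forall (e : R) (Q : set R), 0 < e -> compact Q ->
    exists2 l : R, 0 < l &
      forall a : R, exists2 s : R, a <= s <= a + l &
        forall t x : R, Q x -> `|p (t + s) x - p t x| < e.

Definition time_periodic (R : realType) (tau : R) (p : R -> R -> R) : Prop :=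
  forall t x : R, p (t + tau) x = p t x.

Definition time_stationary (R : realType) (p : R -> R -> R) : Prop :=
  forall t1 t2 x : R, p t1 x = p t2 x.

Definition asymptotically (R : realType) (P : (R -> R -> R) -> Prop)
    (T : set R) (f : T * R -> R) : Prop :=
  exists p r : R -> R -> R,
    [/\ continuous (fun z : R * R => p z.1 z.2),
        continuous (fun z : R * R => r z.1 z.2),
        forall (t : T) (x : R), f (t, x) = p (val t) x + r (val t) x,
        forall Q : set R, compact Q -> forall e : R, 0 < e ->
          \forall t \near +oo, forall x, Q x -> `|r t x| < e
      & P p].

Definition remotely_almost_periodic (R : realType) (phi : R -> R) : Prop :=
  {within @Rplus R, continuous phi} /\
  forall e : R, 0 < e ->
    exists2 l : R, 0 < l &
      forall a : R, 0 <= a -> exists2 s : R, a <= s <= a + l &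
        exists2 L : R, 0 < L &
          forall t : R, L <= t -> `|phi (t + s) - phi t| < e.

Definition remotely_periodic (R : realType) (tau : R) (phi : R -> R) : Prop :=
  {within @Rplus R, continuous phi} /\
  `|phi (t + tau) - phi t| @[t --> +oo] --> (0 : R).

Definition remotely_stationary (R : realType) (phi : R -> R) : Prop :=
  forall s : R, 0 < s -> remotely_periodic s phi.

(* Main.v *)
(** On the limiting equations [x' = g(t, x)], with [g] in the hull of the almost
    periodic part [p], the squared difference of two solutions is nondecreasing.
    Let [D] be the largest distance between two solutions on the whole line,
    bounded by [B], of the same equation.  By compactness [D] is attained, hence
    kept for all later times, and translating to [+oo] gives over every [g] two
    solutions [m], [M] with [M - m = D] everywhere.  Then [g(t, .)] is constant
    between [m(t)] and [M(t)], and every solution bounded by [B] lies there, so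
    it differs from [M] by a constant.  If [s] is a [d]-period of [p] for a small
    [d], then [M(s)] is close to [M(0)]: otherwise there would be, in the limit
    [d -> 0], two solutions of the same equation at distance more than [D].
    The translates of [phi] converge to such solutions, which gives the claim.
    Ultrafilters play the part of diagonal subsequences. *)
Require Import Defs.
From HB Require Import structures.
From mathcomp Require Import all_boot all_order all_algebra.
From mathcomp Require Import all_classical all_reals all_analysis.
From mathcomp Require Import ring lra.
Import Order.TTheory GRing.Theory Num.Theory.
Import numFieldNormedType.Exports.
Local Open Scope classical_set_scope.
Local Open Scope ring_scope.

Set Implicit Arguments.
Unset Strict Implicit.
Unset Printing Implicit Defensive.

(** * Limits along ultrafilters *)

Ltac norm_lra :=
  repeat match goal with
  | H : is_true (`|_| <= _) |- _ => move/ler_normlP: H => [? ?]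
  end; try (apply/ler_normlP; split); lra.

Definition tshift (R : realType) (A : Type) (b : R) (g : R -> A) : R -> A :=
  fun t => g (t + b).

Lemma ultra_bounded_cvg (R : realType) (I : Type) (U : set_system I)
    (u : I -> R) (K : R) :
  UltraFilter U -> (\forall i \near U, `|u i| <= K) ->
  exists l : R, u i @[i --> U] --> l.
Proof.
move=> UU uK.
have Kc := @segment_compact R (- K) K.
have [|l [_ lc]] := Kc (u i @[i --> U]) _.
  by apply: filterS uK => i; rewrite /= in_itv/= ler_norml.
(* Compactness only gives a cluster point [l]. An ultrafilter contains the preimage of [V] or its
   complement, and the complement would contradict clustering at [l]. *)
exists l => V Vl; have [//|UV] := in_ultra_setVsetC (u @^-1` V) UU.
by have [y [/= ny Vy]] := lc (~` V) V UV Vl.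
Qed.

Lemma near_harmonic_le (R : realType) (e : R) :
  0 < e -> \forall n \near \oo, n.+1%:R^-1 <= e.
Proof.
move=> e0; have := near_infty_natSinv_lt (PosNum e0).
by apply: filterS => n /ltW.
Qed.

(** * The hull of the almost periodic part [p] *)

Section AlmostPeriodicHull.
Context (R : realType) (p : R -> R -> R) (B K : R).
Hypothesis p_mono : forall t x y : R,
  `|x| <= B -> `|y| <= B -> x <= y -> p t x <= p t y.
Hypothesis p_bnd : forall t x : R, `|x| <= B -> `|p t x| <= K.
Hypothesis p_uc : forall e : R, 0 < e -> exists2 d : R, 0 < d &
  forall t t' x x' : R, `|x| <= B -> `|x'| <= B ->
    `|t - t'| <= d -> `|x - x'| <= d -> `|p t x - p t' x'| <= e.
Hypothesis p_ap : forall e : R, 0 < e -> exists2 l : R, 0 < l &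
  forall a : R, exists2 s : R, a <= s <= a + l &
    forall t x : R, `|x| <= B -> `|p (t + s) x - p t x| <= e.

Definition unif_close (g g' : R -> R -> R) (e : R) : Prop :=
  forall t x : R, `|x| <= B -> `|g t x - g' t x| <= e.

(* Closeness is uniform in [t] on the whole line, so [g] and [p] have the same
   almost periods. *)
Definition uhull (g : R -> R -> R) : Prop :=
  forall e : R, 0 < e -> exists b, unif_close g (tshift b p) e.

Lemma uhull_shift b g : uhull g -> uhull (tshift b g).
Proof.
move=> Hg e /Hg[c gc]; exists (b + c) => t x xB.
by have := gc (t + b) x xB; rewrite /tshift addrA.
Qed.

Lemma uhull_tshift b : uhull (tshift b p).
Proof. by move=> e e0; exists b => t x xB; rewrite subrr normr0 ltW. Qed.

Lemma uhull_mono g : uhull g -> forall t x y : R,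
  `|x| <= B -> `|y| <= B -> x <= y -> g t x <= g t y.
Proof.
move=> Hg t x y xB yB xy; apply/ler_addgt0Pr => e e0.
have [|b gb] := Hg (e / 2); first by rewrite divr_gt0.
move: (gb t x xB) (gb t y yB) (p_mono (t + b) xB yB xy); rewrite /tshift.
by move=> *; norm_lra.
Qed.

Lemma uhull_bnd g : uhull g -> forall t x : R, `|x| <= B -> `|g t x| <= K.
Proof.
move=> Hg t x xB; apply/ler_addgt0Pr => e /Hg[b gb].
move: (gb t x xB) (p_bnd (t + b) xB); rewrite /tshift.
by move=> *; norm_lra.
Qed.

Lemma uhull_uc (e : R) : 0 < e -> exists2 d : R, 0 < d & forall g, uhull g ->
  forall t t' x x' : R, `|x| <= B -> `|x'| <= B ->
    `|t - t'| <= d -> `|x - x'| <= d -> `|g t x - g t' x'| <= e.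
Proof.
move=> e0; have [|d d0 pd] := p_uc (e := e / 2); first by rewrite divr_gt0.
exists d => // g Hg t t' x x' xB xB' tt xx.
have [|b gb] := Hg (e / 4); first by rewrite divr_gt0.
have tt' : `|t + b - (t' + b)| <= d by rewrite opprD addrACA subrr addr0.
move: (gb t x xB) (gb t' x' xB') (pd _ _ _ _ xB xB' tt' xx); rewrite /tshift.
by move=> *; norm_lra.
Qed.

Lemma uhull_period g (s e : R) : uhull g -> unif_close (tshift s p) p e ->
  unif_close (tshift s g) g e.
Proof.
move=> Hg ps t x xB; apply/ler_addgt0Pr => h h0.
have [|b gb] := Hg (h / 2); first by rewrite divr_gt0.
move: (gb t x xB) (gb (t + s) x xB) (ps (t + b) x xB).
by rewrite /tshift (addrAC t b) => *; norm_lra.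
Qed.

(** Both functions are close to translates of [p], and [p] has almost periods beyond any bound.
    Facts that hold for one [g] only at late times can thus be carried to every member of the
    hull. *)
Lemma uhull_recur g g' (e N : R) : uhull g -> uhull g' -> 0 < e ->
  exists2 b, N <= b & unif_close (tshift b g) g' e.
Proof.
move=> Hg Hg' e0.
have e3 : 0 < e / 3 by rewrite divr_gt0.
have [b gb] := Hg _ e3; have [b' gb'] := Hg' _ e3.
have [l l0 /(_ (N + b - b'))[s /andP[sN _] ps]] := p_ap e3.
(* The shift [b' - b] leads from [tshift b p] to [tshift b' p]; the almost period [s] makes it
   late. *)
exists (s + b' - b); first lra.
move=> t x xB.
move: (gb (t + (s + b' - b)) x xB) (gb' t x xB) (ps (t + b') x xB).
rewrite /tshift (_ : t + (s + b' - b) + b = t + b' + s); last lra.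
by move=> *; norm_lra.
Qed.

(** Pointwise limits exist by boundedness. They stay in the hull because, up to a small error, each
    [g i] is a translate of [p] by some [c i] in a fixed segment [[0, l]], and the [c i] converge
    along [U]. *)
Lemma uhull_compact (I : Type) (U : set_system I) (g : I -> R -> R -> R) :
  UltraFilter U -> (forall i, uhull (g i)) ->
  exists2 g', uhull g' &
    forall t x : R, `|x| <= B -> g i t x @[i --> U] --> g' t x.
Proof.
move=> UU Hg.
have /choice[g' gg'] : forall tx : R * R, exists l : R, `|tx.2| <= B ->
    g i tx.1 tx.2 @[i --> U] --> l.
  move=> [t x]; have [xB|xB] := pselect (`|x| <= B); last by exists 0.
  have [|l gl] := @ultra_bounded_cvg R I U (fun i => g i t x) K UU.
    by apply: nearW => i; exact: uhull_bnd.
  by exists l.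
exists (fun t x => g' (t, x)) => [e e0|t x xB]; last exact: (gg' (t, x)).
have e4 : 0 < e / 4 by rewrite divr_gt0.
have [l l0 pl] := p_ap e4.
have [d d0 pd] := p_uc e4.
have /choice[c gc] : forall i, exists c : R, 0 <= c <= l /\
    unif_close (g i) (tshift c p) (e / 2).
  (* An almost period in [[- b, - b + l]] brings the translation [b] into [[0, l]]. *)
  move=> i; have [b gb] := Hg i _ e4; have [s sb ps] := pl (- b).
  exists (b + s); split; first by move/andP: sb => [*]; apply/andP; split; lra.
  move=> t x xB; move: (gb t x xB) (ps (t + b) x xB); rewrite /tshift addrA.
  by move=> *; norm_lra.
have [|c0 cc0] := @ultra_bounded_cvg R I U c l UU.
  by apply: nearW => i; have [/andP[c0 cl] _] := gc i; rewrite ger0_norm.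
exists c0 => t x xB.
have gtx := gg' (t, x) xB.
near U => i.
have [_ /(_ t x xB) gci] := gc i.
have g1 : `|g' (t, x) - g i t x| <= e / 4.
  by near: i; move/cvgrPdist_le : gtx; exact.
have c1 : `|t + c0 - (t + c i)| <= d.
  by rewrite opprD addrACA subrr add0r; near: i; move/cvgrPdist_le : cc0; exact.
have x0 : `|x - x| <= d by rewrite subrr normr0 ltW.
have := pd _ _ _ _ xB xB c1 x0.
by move: gci g1; rewrite /tshift; clear => *; norm_lra.
Unshelve. all: by end_near. Qed.

End AlmostPeriodicHull.

(** * Bounded solutions of the limiting equations on the whole line *)

Lemma is_derive_ge0_homo (R : realType) (f df : R -> R) :
  (forall t : R, is_derive t 1 f (df t)) -> (forall t : R, 0 <= df t) ->
  {homo f : s t / s <= t}.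
Proof.
move=> fd df0 s t st; apply: (@ger0_derive1_ndecr _ f s t) => //.
- by move=> x _; rewrite derive1E; have -> := @derive_val _ _ _ _ _ _ _ (fd x).
- apply: continuous_subspaceT => x; apply/differentiable_continuous.
  by apply/derivable1_diffP; have [] := fd x.
Qed.

Section FullSolutions.
Context (R : realType) (p : R -> R -> R) (B K : R) (del : R -> R).
Hypothesis p_mono : forall t x y : R,
  `|x| <= B -> `|y| <= B -> x <= y -> p t x <= p t y.
Hypothesis p_bnd : forall t x : R, `|x| <= B -> `|p t x| <= K.
Hypothesis p_uc : forall e : R, 0 < e -> exists2 d : R, 0 < d &
  forall t t' x x' : R, `|x| <= B -> `|x'| <= B ->
    `|t - t'| <= d -> `|x - x'| <= d -> `|p t x - p t' x'| <= e.
Hypothesis p_ap : forall e : R, 0 < e -> exists2 l : R, 0 < l &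
  forall a : R, exists2 s : R, a <= s <= a + l &
    forall t x : R, `|x| <= B -> `|p (t + s) x - p t x| <= e.
Hypothesis del_gt0 : forall e : R, 0 < e -> 0 < del e.

(* The equation [psi' = g(t, psi)], with a modulus of differentiability [del]
   common to all solutions: this form is closed under pointwise limits. *)
Definition full_sol (g : R -> R -> R) (psi : R -> R) : Prop :=
  (forall t : R, `|psi t| <= B) /\
  forall e : R, 0 < e -> forall t h : R, `|h| <= del e ->
    `|psi (t + h) - psi t - h * g t (psi t)| <= e * `|h|.

Lemma full_sol_shift b g psi :
  full_sol g psi -> full_sol (tshift b g) (tshift b psi).
Proof.
move=> [psiB psig]; split=> [t|e e0 t h hd]; first exact: psiB.
by rewrite /tshift (addrAC t h); exact: psig.
Qed.

Lemma full_sol_derive g psi (t : R) :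
  full_sol g psi -> is_derive t 1 psi (g t (psi t)).
Proof.
move=> [psiB psig].
have D : h^-1 *: (psi (h *: 1 + t) - psi t) @[h --> (0 : R)^'] --> g t (psi t).
  apply/cvgrPdist_le => e e0; near=> h.
  have h0 : h != 0 by near: h; exact: nbhs_dnbhs_neq.
  have hd : `|h| <= del e.
    near: h; apply: dnbhs0_le; exact: del_gt0.
  rewrite -(ler_pM2r (_ : 0 < `|h|)) ?normr_gt0// -normrM -normrN -mulNr opprB.
  rewrite mulrBl /= -![_ *: _]/(_ * _) mulr1 mulrAC mulVf// mul1r.
  by rewrite (addrC h) (mulrC (g _ _)); exact: psig.
by apply: DeriveDef; [apply: cvgP D|exact: cvg_lim D].
Unshelve. all: by end_near. Qed.

(** The common modulus of continuity of the hull allows [psi i] to be replaced by its limit inside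
    [h i]. The bounds are asked only eventually along [U], so that translates of a solution on a
    half-line qualify. *)
Lemma full_sol_lim (I : Type) (U : set_system I) (h : I -> R -> R -> R)
    (g : R -> R -> R) (psi : I -> R -> R) :
  UltraFilter U -> (forall i, uhull p B (h i)) ->
  (forall t x : R, `|x| <= B -> h i t x @[i --> U] --> g t x) ->
  (forall t : R, \forall i \near U, `|psi i t| <= B) ->
  (forall e t r : R, 0 < e -> `|r| <= del e -> \forall i \near U,
     `|psi i (t + r) - psi i t - r * h i t (psi i t)| <= e * `|r|) ->
  exists2 chi, full_sol g chi & forall t : R, psi i t @[i --> U] --> chi t.
Proof.
move=> UU Hh hg psiB psih.
have /choice[chi psichi] : forall t : R, exists l : R, psi i t @[i --> U] --> l.
  by move=> t; exact: ultra_bounded_cvg.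
exists chi => //.
have chiB t : `|chi t| <= B.
  apply/ler_addgt0Pr => e e0; near U => i.
  have H1 : `|psi i t| <= B by near: i.
  have H2 : `|chi t - psi i t| <= e.
    by near: i; have /cvgrPdist_le := psichi t; exact.
  norm_lra.
split=> // e e0 t r rd; apply/ler_addgt0Pr => a a0.
have r0 : 0 <= `|r| by [].
(* The error is [b] for each of the two values of [chi], plus [2 * b] multiplied by the step [r] for
   the right-hand side; these add up to [a]. *)
pose b := a / (2 + 2 * `|r|).
have b0 : 0 < b by rewrite divr_gt0//; lra.
have [d d0 hd] := uhull_uc p_uc b0.
near U => i.
have H1 : `|chi (t + r) - psi i (t + r)| <= b.
  by near: i; have /cvgrPdist_le := psichi (t + r); exact.
have H2 : `|chi t - psi i t| <= b.
  by near: i; have /cvgrPdist_le := psichi t; exact.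
have H3 : `|chi t - psi i t| <= d.
  by near: i; have /cvgrPdist_le := psichi t; exact.
have H4 : `|psi i t| <= B by near: i.
have H5 : `|g t (chi t) - h i t (chi t)| <= b.
  by near: i; have /cvgrPdist_le := hg t _ (chiB t); exact.
have H6 : `|psi i (t + r) - psi i t - r * h i t (psi i t)| <= e * `|r|.
  by near: i; exact: psih.
have H7 : `|h i t (chi t) - h i t (psi i t)| <= b.
  by apply: (hd _ (Hh i)) => //; rewrite subrr normr0 ltW.
have H8 : `|r * (g t (chi t) - h i t (psi i t))| <= `|r| * (b + b).
  by rewrite normrM ler_wpM2l//; clear H3; norm_lra.
have H9 : a = b + b + `|r| * (b + b).
  by rewrite -(mulfVK (_ : 2 + 2 * `|r| != 0) a) -/b; [lra | apply/eqP; lra].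
rewrite H9.
move: H1 H2 H6 H8; rewrite mulrBr; clear => *; norm_lra.
Unshelve. all: by end_near. Qed.

Lemma full_sol_lim_uhull (I : Type) (U : set_system I) (h : I -> R -> R -> R)
    (g : R -> R -> R) (psi : I -> R -> R) :
  UltraFilter U -> (forall i, uhull p B (h i)) ->
  (forall t x : R, `|x| <= B -> h i t x @[i --> U] --> g t x) ->
  (forall i, full_sol (h i) (psi i)) ->
  exists2 chi, full_sol g chi & forall t : R, psi i t @[i --> U] --> chi t.
Proof.
move=> UU Hh hg hpsi; apply: full_sol_lim Hh hg _ _ => // [t|e t r e0 rd].
  by apply: nearW => i; have [] := hpsi i.
by apply: nearW => i; have [_] := hpsi i; exact.
Qed.

Lemma full_sol_sqr_derive g psi1 psi2 (t : R) :
  full_sol g psi1 -> full_sol g psi2 ->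
  is_derive t 1 (fun s => (psi1 s - psi2 s) ^+ 2)
    (2 * (psi1 t - psi2 t) * (g t (psi1 t) - g t (psi2 t))).
Proof.
move=> /full_sol_derive-/(_ t) s1 /full_sol_derive-/(_ t) s2.
have -> : (fun s => (psi1 s - psi2 s) ^+ 2) = (psi1 - psi2) ^+ 2.
  by apply/funext => s; rewrite fctE.
apply: is_derive_eq.
by rewrite /= -![_ *: _]/(_ * _) expr1 mulr_natl.
Qed.

(** In the derivative of the square, the differences of the solutions and of their slopes have the
    same sign, as [g t] is nondecreasing. The square avoids the corner of the absolute value at
    zero. *)
Lemma full_sol_sqr_homo g psi1 psi2 : uhull p B g ->
  full_sol g psi1 -> full_sol g psi2 ->
  {homo (fun s => (psi1 s - psi2 s) ^+ 2) : s t / s <= t}.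
Proof.
move=> Hg s1 s2; apply: is_derive_ge0_homo => [t|t].
  exact: full_sol_sqr_derive s1 s2.
have g_mono := uhull_mono p_mono Hg.
have [[B1 _] [B2 _]] := (s1, s2).
rewrite -mulrA mulr_ge0//; have [le12|/ltW le21] := leP (psi1 t) (psi2 t).
  by rewrite mulr_le0// subr_le0// g_mono.
by rewrite mulr_ge0// subr_ge0// g_mono.
Qed.

Lemma extremal_pair (g0 : R -> R -> R) (psi0 : R -> R) :
  uhull p B g0 -> full_sol g0 psi0 -> exists D : R,
  (forall g psi1 psi2, uhull p B g -> full_sol g psi1 -> full_sol g psi2 ->
     forall t : R, `|psi1 t - psi2 t| <= D) /\
  forall g, uhull p B g -> exists M m,
    [/\ full_sol g M, full_sol g m &
        forall t : R, M t - m t = D /\ g t (M t) = g t (m t)].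
Proof.
move=> Hg0 Sg0.
(* Distances at time [0] suffice, since the hull and its solutions are stable under time shifts. *)
pose V := [set v | exists g psi1 psi2, [/\ uhull p B g, full_sol g psi1,
  full_sol g psi2 & v = `|psi1 0 - psi2 0|]].
have V0 : has_sup V.
  split; first by exists `|psi0 0 - psi0 0|, g0, psi0, psi0.
  exists (B + B) => _ [g [psi1 [psi2 [_ [B1 _] [B2 _] ->]]]].
  by apply: le_trans (ler_normB _ _) _; exact: lerD.
pose D := sup V.
have VD g psi1 psi2 : uhull p B g -> full_sol g psi1 -> full_sol g psi2 ->
    forall t : R, `|psi1 t - psi2 t| <= D.
  move=> Hg S1 S2 t; apply: ub_le_sup; first exact: V0.2.
  exists (tshift t g), (tshift t psi1), (tshift t psi2).
  split; [exact: uhull_shift|exact: full_sol_shift|exact: full_sol_shift|].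
  by rewrite /tshift add0r.
have D0 : 0 <= D by apply: le_trans (VD _ _ _ Hg0 Sg0 Sg0 0); exact: normr_ge0.
exists D; split=> //.
have [U [UU sU]] := @ultraFilterLemma nat \oo _.
have /choice[s sP] : forall n : nat,
  exists s : (R -> R -> R) * (R -> R) * (R -> R),
    [/\ uhull p B s.1.1, full_sol s.1.1 s.1.2, full_sol s.1.1 s.2 &
      D - n.+1%:R^-1 <= `|s.1.2 0 - s.2 0|].
  move=> n; have [|_ [g [psi1 [psi2 [Hg S1 S2 ->]]]] /ltW Dv] :=
    @sup_adherent R V n.+1%:R^-1 _ V0; first by rewrite invr_gt0.
  by exists (g, psi1, psi2).
have [|gs Hgs gsP] := uhull_compact p_bnd p_uc p_ap
  (g := fun n => (s n).1.1) UU; first by move=> n; have [] := sP n.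
have [||chi1 Schi1 chi1P] :=
  full_sol_lim_uhull (psi := fun n => (s n).1.2) UU _ gsP.
- by move=> n; have [] := sP n.
- by move=> n; have [] := sP n.
have [||chi2 Schi2 chi2P] :=
  full_sol_lim_uhull (psi := fun n => (s n).2) UU _ gsP.
- by move=> n; have [] := sP n.
- by move=> n; have [] := sP n.
(* [D] is attained at time [0] by [chi1] and [chi2], hence at all [t >= 0]. *)
have chi0 : D <= `|chi1 0 - chi2 0|.
  apply/ler_addgt0Pr => e e0; have e3 : 0 < e / 3 by rewrite divr_gt0.
  near U => n; have [_ _ _ Dn] := sP n.
  have H1 : n.+1%:R^-1 <= e / 3 by near: n; apply: sU; exact: near_harmonic_le.
  have H2 : `|chi1 0 - (s n).1.2 0| <= e / 3.
    by near: n; have /cvgrPdist_le := chi1P 0; exact.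
  have H3 : `|chi2 0 - (s n).2 0| <= e / 3.
    by near: n; have /cvgrPdist_le := chi2P 0; exact.
  have := ler_normB (chi1 0 - chi2 0)
    (chi1 0 - (s n).1.2 0 - (chi2 0 - (s n).2 0)).
  have := ler_normB (chi1 0 - (s n).1.2 0) (chi2 0 - (s n).2 0).
  rewrite (_ : chi1 0 - chi2 0 - (_ - _) = (s n).1.2 0 - (s n).2 0);
    last by ring.
  by move: n.+1%:R^-1 Dn H1 H2 H3; move: `|_| `|_| `|_| `|_| `|_| => *; lra.
have chi_ge0 t : 0 <= t -> (chi1 t - chi2 t) ^+ 2 = D ^+ 2.
  move=> t0; apply/eqP; rewrite eq_le; apply/andP; split.
    by rewrite -(@real_normK _ (chi1 t - _)) ?num_real// lerXn2r// ?nnegrE//;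
      exact: VD Hgs _ _ _.
  apply: le_trans (full_sol_sqr_homo Hgs Schi1 Schi2 t0).
  by rewrite -(@real_normK _ (chi1 0 - _)) ?num_real// lerXn2r ?nnegrE.
move=> g Hg.
have /choice[b bP] : forall n : nat, exists b : R, n%:R <= b /\
    unif_close B (tshift b gs) g n.+1%:R^-1.
  move=> n; have [|b nb gb] := uhull_recur (e := n.+1%:R^-1) p_ap n%:R Hgs Hg.
    by rewrite invr_gt0.
  by exists b.
have gbP t x : `|x| <= B -> tshift (b n) gs t x @[n --> U] --> g t x.
  move=> xB; apply/cvgrPdist_le => e e0; near=> n.
  rewrite distrC; apply: le_trans (_ : n.+1%:R^-1 <= e).
    by have [_] := bP n; exact.
  by near: n; apply: sU; exact: near_harmonic_le.
have [||M SM MP] :=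
  full_sol_lim_uhull (psi := fun n => tshift (b n) chi1) UU _ gbP.
- by move=> n; exact: uhull_shift.
- by move=> n; exact: full_sol_shift.
have [||m Sm mP] :=
  full_sol_lim_uhull (psi := fun n => tshift (b n) chi2) UU _ gbP.
- by move=> n; exact: uhull_shift.
- by move=> n; exact: full_sol_shift.
have MmD t : (M t - m t) ^+ 2 = D ^+ 2.
  have c1 : (tshift (b n) chi1 t - tshift (b n) chi2 t) ^+ 2 @[n --> U] -->
      (M t - m t) ^+ 2.
    by rewrite expr2; under eq_fun do rewrite expr2; apply: cvgM; apply: cvgB.
  have c2 : (tshift (b n) chi1 t - tshift (b n) chi2 t) ^+ 2 @[n --> U] -->
      D ^+ 2.
    (* As [b n >= n], the time [t + b n] is nonnegative as soon as [n >= - t]. *)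
    apply: cvg_near_cst; near=> n; apply: chi_ge0.
    have [nb _] := bP n; suff : - t <= n%:R by lra.
    by near: n; apply: sU; exact: nbhs_infty_ger.
  exact: cvg_unique c1 c2.
have gMm t : g t (M t) = g t (m t).
  have := full_sol_sqr_derive t SM Sm.
  under [X in is_derive _ _ X]eq_fun do rewrite MmD.
  (* The squared difference is constant, so its derivative vanishes: either [M t = m t] or the
     slopes agree, and the first implies the second. *)
  move=> /(@derive_val _ _ _ _ _ _ _); rewrite derive_cst => /esym/eqP.
  rewrite mulf_eq0 mulf_eq0 pnatr_eq0/= !subr_eq0 => /orP[|] /eqP // ->.
  by [].
(* Equal slopes keep [M - m] from switching between [D] and [- D]; if it is [- D], the two solutions
   are exchanged. *)
have Mm_cst t : M t - m t = M 0 - m 0.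
  apply: (@is_derive_0_is_cst R (M - m) t 0) => x.
  have SMx := full_sol_derive x SM; have Smx := full_sol_derive x Sm.
  by apply: is_derive_eq; rewrite gMm subrr.
have /eqP := MmD 0; rewrite eqf_sqr => /orP[] /eqP Mm0.
  by exists M, m; split=> // t; rewrite Mm_cst.
exists m, M; split=> // t; split; last by rewrite gMm.
by rewrite -opprB Mm_cst Mm0 opprK.
Unshelve. all: by end_near. Qed.

Lemma full_sol_rigid D g M m psi : uhull p B g ->
  full_sol g M -> full_sol g m -> full_sol g psi ->
  (forall t : R, M t - m t = D /\ g t (M t) = g t (m t)) ->
  (forall t : R, `|psi t - M t| <= D) -> (forall t : R, `|psi t - m t| <= D) ->
  forall t t' : R, psi t - M t = psi t' - M t'.
Proof.
move=> Hg SM Sm Spsi Mm psiM psim t t'.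
apply: (@is_derive_0_is_cst R (psi - M) t t') => x.
have SMx := full_sol_derive x SM; have Spsix := full_sol_derive x Spsi.
apply: is_derive_eq; apply/eqP; rewrite subr_eq0; apply/eqP.
have g_mono := uhull_mono p_mono Hg.
have [[[MB _] [mB _]] [psiB _]] := (SM, Sm, Spsi).
have [MmD gMm] := Mm x.
(* [g x] is constant on [[m x, M x]], which contains [psi x]. *)
have /andP[mpsi psiM'] : m x <= psi x <= M x.
  (* Distance at most [D] from [M x] gives [psi x >= m x], and from [m x] gives [psi x <= M x]. *)
  by move: (psiM x) (psim x) => *; apply/andP; split; norm_lra.
apply/le_anti/andP; split; first exact: g_mono (psiB x) (MB x) psiM'.
by rewrite gMm; exact: g_mono (mB x) (psiB x) mpsi.
Qed.

(** One [d] has to serve all [s], [g] and [psi]. Failure yields a sequence of counterexamples with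
    ever better almost periods [s], possibly unbounded, to which compactness of the hull applies. *)
Lemma full_sol_modulus (e : R) : 0 < e -> exists2 d : R, 0 < d &
  forall s g psi, unif_close B (tshift s p) p d -> uhull p B g ->
    full_sol g psi -> `|psi s - psi 0| < e.
Proof.
move=> e0; apply: contrapT => /forall2NP Ne.
have /choice[q qP] : forall n : nat, exists q : R * (R -> R -> R) * (R -> R),
    [/\ unif_close B (tshift q.1.1 p) p n.+1%:R^-1, uhull p B q.1.2,
      full_sol q.1.2 q.2 & e <= `|q.2 q.1.1 - q.2 0|].
  move=> n; have [/negP|] := Ne n.+1%:R^-1; first by rewrite invr_gt0 ltr0Sn.
  apply: contra_notP => Nq s g psi ps Hg Sg; rewrite ltNge; apply/negP => es.
  by apply: Nq; exists (s, g, psi).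
have [_ H0 S0 _] := qP 0.
have [D [Dle DP]] := extremal_pair H0 S0.
(* By rigidity each offending solution differs from the upper extremal one by a constant, so the
   extremal one has the same jump between [0] and [s]. *)
have /choice[w wP] : forall n : nat, exists w : (R -> R) * (R -> R),
    [/\ full_sol (q n).1.2 w.1, full_sol (q n).1.2 w.2,
      forall t : R, w.1 t - w.2 t = D & e <= `|w.1 (q n).1.1 - w.1 0|].
  move=> n; have [_ Hn Sn en] := qP n; have [M [m [SM Sm Mm]]] := DP _ Hn.
  exists (M, m); split=> //= [t|]; first by have [] := Mm t.
  suff : (q n).2 (q n).1.1 - M (q n).1.1 = (q n).2 0 - M 0.
    by move=> H; rewrite (_ : M _ - M 0 = (q n).2 (q n).1.1 - (q n).2 0); lra.
  apply: (full_sol_rigid Hn SM Sm Sn Mm) => t.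
  - exact: Dle Hn Sn SM t.
  - exact: Dle Hn Sn Sm t.
have [U [UU sU]] := @ultraFilterLemma nat \oo _.
have [|g Hg gP] := uhull_compact p_bnd p_uc p_ap
  (g := fun n => (q n).1.2) UU; first by move=> n; have [] := qP n.
(* The shifts are almost periods with error tending to [0], so the shifted equations have the same
   limit [g]; the limits taken around [0] and around [s] can then be compared. *)
have gsP t x : `|x| <= B ->
    tshift (q n).1.1 (q n).1.2 t x @[n --> U] --> g t x.
  move=> xB; apply/cvgrPdist_le => a a0.
  have a2 : 0 < a / 2 by rewrite divr_gt0.
  near=> n.
  have H1 : `|g t x - (q n).1.2 t x| <= a / 2.
    by near: n; have /cvgrPdist_le := gP t x xB; exact.
  have H2 : n.+1%:R^-1 <= a / 2 by near: n; apply: sU; exact: near_harmonic_le.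
  have [ps Hn _ _] := qP n.
  rewrite (splitr a); apply: le_trans (ler_distD _ _ _) (lerD H1 _).
  by rewrite distrC; apply: le_trans (uhull_period Hn ps t xB) H2.
have [||A0 SA0 A0P] := full_sol_lim_uhull (psi := fun n => (w n).1) UU _ gP.
- by move=> n; have [] := qP n.
- by move=> n; have [] := wP n.
have [||a0 Sa0 a0P] := full_sol_lim_uhull (psi := fun n => (w n).2) UU _ gP.
- by move=> n; have [] := qP n.
- by move=> n; have [] := wP n.
have [||A1 SA1 A1P] :=
  full_sol_lim_uhull (psi := fun n => tshift (q n).1.1 (w n).1) UU _ gsP.
- by move=> n; apply: uhull_shift; have [] := qP n.
- by move=> n; apply: full_sol_shift; have [] := wP n.
have [||a1 Sa1 a1P] :=
  full_sol_lim_uhull (psi := fun n => tshift (q n).1.1 (w n).2) UU _ gsP.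
- by move=> n; apply: uhull_shift; have [] := qP n.
- by move=> n; apply: full_sol_shift; have [] := wP n.
(* [A0 - a0 = A1 - a1 = D] and [|A1 0 - A0 0| >= e], so one of [A1 - a0] and
   [A0 - a1] exceeds [D] at [0]. *)
have e8 : 0 < e / 8 by rewrite divr_gt0.
near U => n.
have H1 : `|A0 0 - (w n).1 0| <= e / 8.
  by near: n; have /cvgrPdist_le := A0P 0; exact.
have H2 : `|a0 0 - (w n).2 0| <= e / 8.
  by near: n; have /cvgrPdist_le := a0P 0; exact.
have H3 : `|A1 0 - (w n).1 (q n).1.1| <= e / 8.
  rewrite -[X in (w n).1 X]add0r.
  by near: n; have /cvgrPdist_le := A1P 0; exact.
have H4 : `|a1 0 - (w n).2 (q n).1.1| <= e / 8.
  rewrite -[X in (w n).2 X]add0r.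
  by near: n; have /cvgrPdist_le := a1P 0; exact.
have [_ _ wD en] := wP n.
have := wD 0; have := wD (q n).1.1.
have := Dle _ _ _ Hg SA1 Sa0 0; have := Dle _ _ _ Hg SA0 Sa1 0.
move: H1 H2 H3 H4 en e0; rewrite ler_normr; clear => ? ? ? ? /orP[] *; norm_lra.
Unshelve. all: by end_near. Qed.

(** Along an ultrafilter of bad times going to [+oo], translates of [phi] converge to a full
    solution over a member of the hull, which would still jump by at least [e] over the almost
    period [s]. *)
Lemma asymptotic_modulus (phi : R -> R) :
  (forall t : R, 0 <= t -> `|phi t| <= B) ->
  (forall e : R, 0 < e -> \forall t \near +oo, forall h : R, `|h| <= del e ->
     `|phi (t + h) - phi t - h * p t (phi t)| <= e * `|h|) ->
  forall e : R, 0 < e -> exists2 d : R, 0 < d &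
    forall s, unif_close B (tshift s p) p d ->
      \forall t \near +oo, `|phi (t + s) - phi t| < e.
Proof.
move=> phiB phip e e0.
have [d d0 dP] := full_sol_modulus e0; exists d => // s ps.
apply: contrapT => Ns.
(* [s] stays fixed in the limit, so that both [phi t] and [phi (t + s)] are
   values of one and the same limit solution. *)
pose A := [set t : R | e <= `|phi (t + s) - phi t|].
(* If [A] missed a neighbourhood of [+oo], the claim would hold for [s]. *)
have PA : ProperFilter (within A (pinfty_nbhs R)).
  apply: Build_ProperFilter_ex => P yAP; apply: contrapT => NP; apply: Ns.
  apply: (@filterS _ (pinfty_nbhs R) _ _ _ _ yAP) => t AP.
  by rewrite ltNge; apply/negP => At; apply: NP; exists t; exact: AP.
have [U [UU sU]] := ultraFilterLemma PA.
have sUy P : (\forall t \near +oo, P t) -> U P.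
  by move=> yP; apply: sU; exact: filterS yP.
have [|g Hg gP] := uhull_compact p_bnd p_uc p_ap
  (g := fun t : R => tshift t p) UU; first by move=> t; exact: uhull_tshift.
have shift_y (r : R) (P : set R) :
    (\forall t \near +oo, P t) -> (\forall t \near +oo, P (r + t)).
  by move=> [N [Nr NP]]; exists (N - r); split=> [|t Nt];
    [exact: num_real|apply: NP; rewrite -ltrBlDl].
have [|||chi Schi chiP] := full_sol_lim
  (psi := fun t : R => tshift t phi) UU _ gP.
- by move=> t; exact: uhull_tshift.
- move=> t; apply: sUy; near=> u; apply: phiB.
  suff : - t <= u by lra.
  by near: u; apply: nbhs_pinfty_ge; rewrite num_real.
- move=> a t r a0 rd; apply: sUy.
  have := shift_y t _ (phip a a0); apply: filterS => u /(_ r rd).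
  by rewrite /tshift (addrAC t r u).
have := dP s g chi ps Hg Schi; apply/negP; rewrite -leNgt.
apply/ler_addgt0Pr => a a0; have a2 : 0 < a / 2 by rewrite divr_gt0.
near U => t.
have H1 : `|chi s - phi (t + s)| <= a / 2.
  by rewrite (addrC t); near: t; have /cvgrPdist_le := chiP s; exact.
have H2 : `|chi 0 - phi t| <= a / 2.
  by rewrite -[X in phi X]add0r; near: t; have /cvgrPdist_le := chiP 0; exact.
have : e <= `|phi (t + s) - phi t|.
  by near: t; apply: sU; apply: nearW.
move: H1 H2; rewrite -lerBlDr !ler_normr; clear => ? ? /orP[] *; apply/orP;
  by [left; norm_lra|right; norm_lra].
Unshelve. all: by end_near. Qed.

End FullSolutions.

(** * Uniform estimates for almost periodic functions *)

Lemma rectangle_unif_continuous (R : realType) (p : R -> R -> R) (l B e : R) :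
  continuous (fun z : R * R => p z.1 z.2) -> 0 < e -> exists2 d : R, 0 < d &
  forall t t' x x' : R, `|t| <= l -> `|t'| <= l -> `|x| <= B -> `|x'| <= B ->
    `|t - t'| <= d -> `|x - x'| <= d -> `|p t x - p t' x'| <= e.
Proof.
(* Heine's argument: ever closer pairs of points with values more than [e] apart would have a common
   limit [(t0, x0)], against continuity there. *)
move=> pc e0; apply: contrapT => /forall2NP Ne.
have /choice[q qP] : forall n : nat, exists q : R * R * (R * R),
    [/\ [/\ `|q.1.1| <= l, `|q.1.2| <= l, `|q.2.1| <= B & `|q.2.2| <= B],
      `|q.1.1 - q.1.2| <= n.+1%:R^-1, `|q.2.1 - q.2.2| <= n.+1%:R^-1
      & e < `|p q.1.1 q.2.1 - p q.1.2 q.2.2| ].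
  move=> n; have [/negP|] := Ne n.+1%:R^-1; first by rewrite invr_gt0 ltr0Sn.
  apply: contra_notP => Nq t t' x x' tl tl' xB xB' tt xx.
  rewrite leNgt; apply/negP => es.
  by apply: Nq; exists (t, t', (x, x')).
have [U [UU sU]] := @ultraFilterLemma nat \oo _.
have [|t0 t0P] := @ultra_bounded_cvg R nat U (fun n => (q n).1.1) l UU.
  by apply: nearW => n; have [[]] := qP n.
have [|x0 x0P] := @ultra_bounded_cvg R nat U (fun n => (q n).2.1) B UU.
  by apply: nearW => n; have [[]] := qP n.
have close (u v : nat -> R) (a : R) : u n @[n --> U] --> a ->
    (forall n, `|u n - v n| <= n.+1%:R^-1) -> v n @[n --> U] --> a.
  move=> ua uv; apply/cvgrPdist_le => b b0; near=> n.
  rewrite (splitr b); apply: le_trans (ler_distD (u n) _ _) (lerD _ _).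
    by near: n; have /cvgrPdist_le := ua; apply; rewrite divr_gt0.
  apply: le_trans (uv n) _; near: n; apply: sU; apply: near_harmonic_le.
  by rewrite divr_gt0.
have t0P' : (q n).1.2 @[n --> U] --> t0.
  by apply: close t0P _ => n; have [] := qP n.
have x0P' : (q n).2.2 @[n --> U] --> x0.
  by apply: close x0P _ => n; have [] := qP n.
have p_cvg (u v : nat -> R) : u n @[n --> U] --> t0 -> v n @[n --> U] --> x0 ->
    p (u n) (v n) @[n --> U] --> p t0 x0.
  by move=> ut vx; apply: (cvg_comp _ _ (cvg_pair ut vx) (pc (t0, x0))).
near U => n; have [_ _ _] := qP n; apply/negP; rewrite -leNgt (splitr e).
apply: le_trans (ler_distD (p t0 x0) _ _) (lerD _ _); [rewrite distrC|];
  near: n.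
  by have /cvgrPdist_le := p_cvg _ _ t0P x0P; apply; rewrite divr_gt0.
by have /cvgrPdist_le := p_cvg _ _ t0P' x0P'; apply; rewrite divr_gt0.
Unshelve. all: by end_near. Qed.

Lemma rectangle_bounded (R : realType) (p : R -> R -> R) (l B : R) :
  continuous (fun z : R * R => p z.1 z.2) -> exists K : R,
  forall t x : R, `|t| <= l -> `|x| <= B -> `|p t x| <= K.
Proof.
move=> pc.
have Ac : compact (`[- l, l] `*` `[- B, B] : set (R * R)).
  by apply: compact_setX; exact: segment_compact.
have /compact_bounded[K [_ KP]] :=
  continuous_compact (continuous_subspaceT pc) Ac.
exists (K + 1) => t x tl xB; apply: (KP (K + 1)); first by rewrite ltrDl.
by exists (t, x) => //; split; rewrite /= in_itv/= -ler_norml.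
Qed.

Section AlmostPeriodicFunctions.
Context (R : realType) (p : R -> R -> R) (B : R).
Hypothesis p_cont : continuous (fun z : R * R => p z.1 z.2).
Hypothesis p_apu : almost_periodic_unif p.

Lemma almost_periodic_ball (e : R) : 0 < e -> exists2 l : R, 0 < l &
  forall a : R, exists2 s : R, a <= s <= a + l &
    forall t x : R, `|x| <= B -> `|p (t + s) x - p t x| <= e.
Proof.
move=> e0; have [l l0 lP] := p_apu e0 (@segment_compact R (- B) B).
exists l => // a; have [s sa sP] := lP a; exists s => // t x xB.
by apply/ltW/sP; rewrite /= in_itv/= -ler_norml.
Qed.

Lemma almost_periodic_bounded :
  exists K : R, forall t x : R, `|x| <= B -> `|p t x| <= K.
Proof.
have [l l0 lP] := almost_periodic_ball ltr01.
have [K KP] := rectangle_bounded l B p_cont.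
(* An almost period in [[- t, - t + l]] moves [t] into [[0, l]], at the cost of an error [1]. *)
exists (K + 1) => t x xB; have [s /andP[st sl] sP] := lP (- t).
have ts : `|t + s| <= l by norm_lra.
by move: (KP _ _ ts xB) (sP t x xB) => *; norm_lra.
Qed.

Lemma almost_periodic_unif_continuous (e : R) : 0 < e -> exists2 d : R, 0 < d &
  forall t t' x x' : R, `|x| <= B -> `|x'| <= B ->
    `|t - t'| <= d -> `|x - x'| <= d -> `|p t x - p t' x'| <= e.
Proof.
move=> e0; have e3 : 0 < e / 3 by rewrite divr_gt0.
have [l l0 lP] := almost_periodic_ball e3.
have [d d0 dP] := rectangle_unif_continuous (l + 1) B p_cont e3.
(* With times at most [1] apart, the almost period that moves [t] into [[0, l]] keeps [t'] in the
   rectangle of half-width [l + 1]. *)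
exists (Num.min d 1) => [|t t' x x' xB xB']; first by rewrite lt_min d0/=.
rewrite !le_min => /andP[ttd tt1] /andP[xxd _].
have [s /andP[st sl] sP] := lP (- t).
have ts : `|t + s| <= l + 1 by norm_lra.
have ts' : `|t' + s| <= l + 1 by norm_lra.
have tts : `|t + s - (t' + s)| <= d by rewrite opprD addrACA subrr addr0.
move: (dP _ _ _ _ ts ts' xB xB' tts xxd) (sP t x xB) (sP t' x' xB').
by clear => *; norm_lra.
Qed.

(** A late almost period carries [t] to a time where the sum is monotone and [r] is small. *)
Lemma almost_periodic_mono (r : R -> R -> R) :
  (forall e : R, 0 < e ->
     \forall t \near +oo, forall x : R, `|x| <= B -> `|r t x| < e) ->
  (\forall t \near +oo, forall x y : R,
     x <= y -> p t x + r t x <= p t y + r t y) ->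
  forall t x y : R, `|x| <= B -> `|y| <= B -> x <= y -> p t x <= p t y.
Proof.
move=> r0 [N [_ NP]] t x y xB yB xy; apply/ler_addgt0Pr => e e0.
have e4 : 0 < e / 4 by rewrite divr_gt0.
have [M [_ MP]] := r0 _ e4.
have [l l0 /(_ (Num.max N M + 1 - t))[s /andP[sN _] sP]] :=
  almost_periodic_ball e4.
have /andP[Nt Mt] : (N < t + s) && (M < t + s) by rewrite -gt_max; lra.
move: (NP _ Nt x y xy) (MP _ Mt x xB) (MP _ Mt y yB) (sP t x xB) (sP t y yB).
by move=> ? /ltW ? /ltW ? ? ?; clear Nt Mt sN; norm_lra.
Qed.

End AlmostPeriodicFunctions.

Lemma time_periodicMz (R : realType) (tau : R) (p : R -> R -> R) (k : int) t x :
  time_periodic tau p -> p (t + k%:~R * tau) x = p t x.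
Proof.
move=> pt.
have pn (n : nat) u : p (u + n%:R * tau) x = p u x.
  elim: n u => [|n IHn] u; rewrite ?mul0r ?addr0//.
  by rewrite -natr1 mulrDl mul1r addrA pt.
case: k => n; first exact: pn.
by rewrite NegzE -(pn n.+1 (t + _)) mulrNz mulNr subrK.
Qed.

Lemma time_periodic_almost_periodic (R : realType) (tau : R) (p : R -> R -> R) :
  0 < tau -> time_periodic tau p -> almost_periodic_unif p.
Proof.
move=> tau0 pt e Q e0 _; exists tau => // a.
(* The first multiple of [tau] that is at least [a]. *)
exists ((Num.ceil (a / tau))%:~R * tau) => [|t x _].
  have /andP[ck kc] := ceil_itv (a / tau).
  rewrite -ler_pdivrMr// kc/= -ler_pdivlMr// mulrDl divff ?gt_eqF//.
  by rewrite -lerBlDr; move: ck; rewrite intrB => /ltW.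
by rewrite time_periodicMz// subrr normr0.
Qed.

(** * Solutions of the original equation on the half-line *)

Lemma MVT_ball (R : realType) (f df : R -> R) (a h : R) :
  (forall x : R, `|x - a| <= `|h| -> is_derive x 1 f (df x)) ->
  exists2 c, `|c - a| <= `|h| & f (a + h) - f a = h * df c.
Proof.
move=> fd.
have mvt u v : u <= v -> (forall x : R, x \in `[u, v] -> `|x - a| <= `|h|) ->
    exists2 c, `|c - a| <= `|h| & f v - f u = df c * (v - u).
  move=> uv uvh; have [x xuv| |c cuv ->] := MVT_segment (f := f) (df := df) uv.
  - by apply/fd/uvh; exact: subset_itv_oo_cc xuv.
  - apply: derivable_within_continuous => x xuv.
    by have [] := fd x (uvh x xuv).
  by exists c => //; exact: uvh.
have [h0|/ltW h0] := leP 0 h.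
  have [||c ca E] := mvt a (a + h); [by rewrite lerDl| |].
    by move=> x; rewrite in_itv/= => /andP[*]; rewrite (ger0_norm h0); norm_lra.
  by exists c; rewrite // E addrC addKr mulrC.
have [||c ca E] := mvt (a + h) a; [by rewrite gerDl| |].
  by move=> x; rewrite in_itv/= => /andP[*]; rewrite (ler0_norm h0); norm_lra.
by exists c; rewrite // -opprB E opprD addNKr mulrN opprK mulrC.
Qed.

Section Solutions.
Context (R : realType) (T : set R) (f : T * R -> R) (v : R) (y : R -> R).
Hypothesis y_sol : solution f v y.

Lemma solution_quotient (t : T) (e : R) : 0 <= val t -> 0 < e ->
  exists2 d : R, 0 < d & forall h : R, `|h| < d -> h != 0 -> 0 <= val t + h ->
    `|f (t, y (val t)) - h^-1 * (y (val t + h) - y (val t))| <= e.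
Proof.
move=> t0 e0; have /cvgrPdist_le/(_ e e0) := y_sol.2 t t0.
rewrite near_withinE /dnbhs near_withinE => /nbhs_ballP[d /= d0 dP].
exists d => // h hd h0 th; apply: dP => //.
by rewrite /ball/= sub0r normrN.
Qed.

Lemma solution_derive (t : T) : 0 < val t ->
  is_derive (val t) 1 y (f (t, y (val t))).
Proof.
move=> t0.
have D : h^-1 *: (y (h *: 1 + val t) - y (val t)) @[h --> (0 : R)^'] -->
    f (t, y (val t)).
  apply/cvgrPdist_le => e e0; have [d d0 dP] := solution_quotient (ltW t0) e0.
  near=> h; rewrite -![_ *: _]/(_ * _) mulr1 addrC (addrC h).
  rewrite [X in `|X|]addrC; apply: dP.
  - by near: h; exact: dnbhs0_lt.
  - by near: h; exact: nbhs_dnbhs_neq.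
  have : `|h| <= val t by near: h; exact: dnbhs0_le.
  by move=> *; norm_lra.
by apply: DeriveDef; [apply: cvgP D|exact: cvg_lim D].
Unshelve. all: by end_near. Qed.

Lemma solution_continuous : (@Rplus R `<=` T) ->
  {within @Rplus R, continuous y}.
Proof.
move=> RT; apply/subspace_continuousP => t t0.
pose t' : T := SigSub (mem_set (RT t t0)).
(* Difference quotients within [1] of the slope [C] give the local bound [|C| + 1], also at [t = 0],
   where they are one-sided. *)
have [d d0 dP] := solution_quotient (t := t') t0 ltr01.
set C := f _ in dP.
apply/cvgrPdist_le => e e0; rewrite near_withinE; near=> u => u0.
have C0 : 0 < `|C| + 1 by rewrite ltr_wpDl.
have ud : `|u - t| < d by near: u; exact: cvgr_distC_lt.
have ue : `|u - t| <= e / (`|C| + 1).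
  by near: u; apply: cvgr_distC_le => //; rewrite divr_gt0.
have [->|ut] := eqVneq u t; first by rewrite subrr normr0 ltW.
have := dP _ ud; rewrite subr_eq0 addrC subrK => /(_ ut u0) H.
have H1 : `|(u - t)^-1 * (y u - y t)| <= `|C| + 1.
  have := ler_normB C (C - (u - t)^-1 * (y u - y t)).
  by rewrite opprB addrC subrK => /le_trans; apply; rewrite lerD2l.
rewrite distrC -(@mulVKf _ (u - t) _ (y u - y t)) ?subr_eq0// normrM.
by rewrite -(@divfK _ (`|C| + 1) _ e) ?gt_eqF// ler_pM.
Unshelve. all: by end_near. Qed.

End Solutions.

(** Up to the vanishing [r], [phi] solves [x' = p(t, x)]; the mean value theorem turns this into the
    estimate that [asymptotic_modulus] asks for. *)
Lemma solution_asymptotic_modulus (R : realType) (T : set R) (f : T * R -> R)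
    (u0 : R) (phi : R -> R) (p r : R -> R -> R) :
  @Rplus R `<=` T ->
  (forall x1 x2 : R, x1 <= x2 -> forall t : T, f (t, x1) <= f (t, x2)) ->
  solution f u0 phi -> [bounded phi t | t in @Rplus R] ->
  continuous (fun z : R * R => p z.1 z.2) -> almost_periodic_unif p ->
  (forall (t : T) (x : R), f (t, x) = p (val t) x + r (val t) x) ->
  (forall Q : set R, compact Q -> forall e : R, 0 < e ->
     \forall t \near +oo, forall x : R, Q x -> `|r t x| < e) ->
  exists B : R, forall e : R, 0 < e -> exists2 d : R, 0 < d & forall s,
    (forall t x : R, `|x| <= B -> `|p (t + s) x - p t x| <= d) ->
    \forall t \near +oo, `|phi (t + s) - phi t| < e.
Proof.
move=> RT f_mono phi_sol [B [_ /(_ (B + 1))phiB]] p_cont p_ap fpr r0.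
have {}phiB (t : R) : 0 <= t -> `|phi t| <= B + 1 by apply: phiB; rewrite ltrDl.
exists (B + 1); move: (B + 1) phiB => {}B phiB.
have [K KP] := almost_periodic_bounded B p_cont p_ap.
have /choice[d dP] : forall e : R, exists d : R, 0 < e -> 0 < d /\
    forall t t' x x' : R, `|x| <= B -> `|x'| <= B ->
      `|t - t'| <= d -> `|x - x'| <= d -> `|p t x - p t' x'| <= e.
  move=> e; have [e0|ne0] := pselect (0 < e); last by exists 0.
  have [d d0 dP] := almost_periodic_unif_continuous B p_cont p_ap e0.
  by exists d.
have r0B (e : R) : 0 < e ->
    \forall t \near +oo, forall x : R, `|x| <= B -> `|r t x| < e.
  move=> e0; have := r0 _ (@segment_compact R (- B) B) e e0.
  apply: filterS => t rt x xB; apply: rt; by rewrite /= in_itv/= -ler_norml.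
have K1 : 0 < `|K| + 1 by rewrite ltr_wpDl.
(* The first bound controls the change of time. The second controls the change of [phi], whose slope
   is eventually at most [|K| + 1]. *)
pose del e := Num.min (d (e / 2)) (d (e / 2) / (`|K| + 1)).
have e2 (e : R) : 0 < e -> 0 < e / 2 by move=> ?; rewrite divr_gt0.
have phi_derive (t : R) : 0 < t ->
    is_derive t 1 phi (p t (phi t) + r t (phi t)).
  move=> t0; pose t' : T := SigSub (mem_set (RT t (ltW t0))).
  by rewrite -(fpr t'); exact: (solution_derive phi_sol (t := t')).
apply: (@asymptotic_modulus R p B K del) => //.
- apply: (almost_periodic_mono p_ap r0B).
  near=> t; have t0 : 0 <= t by near: t; apply: nbhs_pinfty_ge; exact: num_real.
  move=> x x' xx'; pose t' : T := SigSub (mem_set (RT t t0)).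
  by rewrite -!(fpr t'); exact: f_mono.
- by move=> e; exact: almost_periodic_unif_continuous.
- by move=> e; exact: almost_periodic_ball.
- move=> e /e2/dP[d0 _]; rewrite lt_min d0/= divr_gt0//.
move=> e e0; have [d0 {}dP] := dP _ (e2 _ e0).
(* The bound [1] on [r] enters the slope estimate, and [e / 2] is the share of [r] in the final
   error. *)
have m0 : 0 < Num.min 1 (e / 2) by rewrite lt_min ltr01 e2.
have [N [_ NP]] := r0B _ m0.
near=> t => h; rewrite le_min => /andP[hd hdK].
have near_t (c : R) : `|c - t| <= `|h| -> 0 < c /\ N < c.
  have : 0 < t - d (e / 2).
    by rewrite subr_gt0; near: t; apply: nbhs_pinfty_gt; exact: num_real.
  have : N < t - d (e / 2).
    by rewrite ltrBrDr; near: t; apply: nbhs_pinfty_gt; exact: num_real.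
  by move=> ? ? /le_trans/(_ hd) ?; split; norm_lra.
have phi'_le (c : R) : `|c - t| <= `|h| ->
    `|p c (phi c) + r c (phi c)| <= `|K| + 1.
  move=> /near_t[c0 Nc]; have cB := phiB c (ltW c0).
  apply: le_trans (ler_normD _ _) (lerD _ _).
    exact: le_trans (KP c _ cB) (ler_norm _).
  by apply: ltW; apply: lt_le_trans (NP c Nc _ cB) _; rewrite ge_min lexx.
have [c ch ->] := MVT_ball (fun x xh => phi_derive x (near_t x xh).1).
have phi_c : `|phi c - phi t| <= d (e / 2).
  have [x xh] := MVT_ball (a := t) (h := c - t)
    (fun x xh => phi_derive x (near_t x (le_trans xh ch)).1).
  rewrite (addrC t) subrK => ->; rewrite normrM.
  rewrite -(@divfK _ (`|K| + 1) _ (d _)) ?gt_eqF// ler_pM//.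
    exact: le_trans ch hdK.
  exact: phi'_le (le_trans xh ch).
rewrite -mulrBr normrM mulrC ler_wpM2r//.
have [c0 Nc] := near_t c ch; have cB := phiB c (ltW c0).
have [t0 _] : 0 < t /\ N < t by apply: near_t; rewrite subrr normr0.
rewrite addrAC (splitr e); apply: le_trans (ler_normD _ _) (lerD _ _).
  by apply: dP; [exact: cB|exact: phiB (ltW t0)|exact: le_trans ch hd|].
by apply: ltW; apply: lt_le_trans (NP c Nc _ cB) _; rewrite ge_min lexx orbT.
Unshelve. all: by end_near. Qed.

(** * The almost periodic, periodic and stationary cases *)

Theorem theorem1p10 (R : realType) (T : set R)
    (hT : T = @Rplus R \/ T = [set: R])
    (f : T * R -> R) (f_cont : continuous f)
    (f_reg : positively_regular f)
    (f_mono : forall x1 x2 : R, x1 <= x2 -> forall t : T, f (t, x1) <= f (t, x2))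
    (u0 : R) (phi : R -> R) (phi_sol : solution f u0 phi)
    (phi_bounded : [bounded phi t | t in @Rplus R]) :
  [/\ asymptotically (@almost_periodic_unif R) f ->
        remotely_almost_periodic phi,
      forall tau : R, 0 < tau ->
        asymptotically (time_periodic tau) f -> remotely_periodic tau phi
    & asymptotically (@time_stationary R) f -> remotely_stationary phi].
Proof.
have RT : @Rplus R `<=` T by case: hT => -> // t _.
have phi_cont := solution_continuous phi_sol RT.
have periodic tau : 0 < tau -> asymptotically (time_periodic tau) f ->
    remotely_periodic tau phi.
  move=> tau0 [p [r [p_cont _ fpr r0 p_per]]]; split=> //.
  have [B modP] := solution_asymptotic_modulus RT f_mono phi_sol phi_bounded
    p_cont (time_periodic_almost_periodic tau0 p_per) fpr r0.
  apply/cvgrPdist_lt => e e0; have [d d0 dP] := modP e e0.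
  have := dP tau; under eq_near do rewrite sub0r normrN normr_id.
  (* An exact period of [p] is an almost period for every [d], so [tau] itself can serve as [s]. *)
  by apply=> t x _; rewrite p_per subrr normr0 ltW.
split=> // [[p [r [p_cont _ fpr r0 p_ap]]]|].
  split=> // e e0.
  have [B modP] := solution_asymptotic_modulus RT f_mono phi_sol phi_bounded
    p_cont p_ap fpr r0.
  have [d d0 dP] := modP e e0.
  have [l l0 lP] := p_ap d _ d0 (@segment_compact R (- B) B).
  exists l => // a _; have [s sa sP] := lP a; exists s => //.
  have [|N [_ NP]] := dP s.
    by move=> t x xB; apply/ltW/sP; rewrite /= in_itv/= -ler_norml.
  exists (`|N| + 1) => [|t Nt]; first by rewrite ltr_wpDl.
  by apply: NP; rewrite (lt_le_trans _ Nt)// (le_lt_trans (ler_norm N))// ltrDl.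
by move=> [p [r [*]]] s s0; apply: periodic => //; exists p, r; split.
Qed.
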